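(* Let $H$ be a quantum commutative weak Hopf algebra with antipode $S$ over a field $\mathbf{k}$. Define the adjoint action of $H$ on $H$ by $$h\rightharpoonup x=h_1xS(h_2)\quad\text{for all } h,x\in H.$$ Then, with $H$ regarded as a left $H$-module via $\rightharpoonup$, the triple $(H,\Pi^L,\Pi^L)$ is a Rota-Baxter paired $H$-module of weight $-1$.
   Context: Sweedler notation $\Delta(h)=h_1\otimes h_2$ is used, and $\Delta(1_H)=1_1\otimes 1_2$. A weak bialgebra over $\mathbf{k}$ is a $\mathbf{k}$-vector space $H$ that is both a (unital associative) algebra and a (counital coassociative) coalgebra such that for all $x,y,z\in H$: (i) $\Delta(xy)=\Delta(x)\Delta(y)$; (ii) $\varepsilon(xyz)=\varepsilon(xy_1)\varepsilon(y_2z)=\varepsilon(xy_2)\varepsilon(y_1z)$; (iii) $\Delta^2(1_H)=(\Delta(1_H)\otimes 1_H)(1_H\otimes\Delta(1_H))=(1_H\otimes\Delta(1_H))(\Delta(1_H)\otimes 1_H)$, where $\Delta^2=(\Delta\otimes\mathrm{id}_H)\circ\Delta$. The target and source maps are $\Pi^L(h)=\varepsilon(1_1h)1_2$ and $\Pi^R(h)=\varepsilon(h1_2)1_1$. A weak Hopf algebra is a weak bialgebra with a linear map $S:H\to H$ (the antipode) such that $x_1S(x_2)=\Pi^L(x)$, $S(x_1)x_2=\Pi^R(x)$ and $S(x_1)x_2S(x_3)=S(x)$ for all $x\in H$. It is quantum commutative if $h_1g\,\Pi^R(h_2)=hg$ for all $h,g\in H$. For an algebra $B$, a left $B$-module $M$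 and $\mathbf{k}$-linear maps $P:B\to B$, $T:M\to M$, the triple $(M,P,T)$ is a Rota-Baxter paired $B$-module of weight $\lambda\in\mathbf{k}$ if $$P(b)\cdot T(m)=T(P(b)\cdot m)+T(b\cdot T(m))+\lambda T(b\cdot m)\quad\text{for all } b\in B,\ m\in M.$$ *)

(* Defs.v *)
From HB Require Import structures.
From mathcomp Require Import all_boot all_algebra.
From mathcomp Require Import boolp.

Set Implicit Arguments.
Unset Strict Implicit.
Unset Printing Implicit Defensive.

Import GRing.Theory.
Local Open Scope ring_scope.
Local Open Scope quotient_scope.

Notation is_bilinear f := (bilinear_for *:%R *:%R f).

(* The tensor product of two vector spaces: a list [:: (u_1, v_1); ...] stands
   for the formal sum of the u_i (x) v_i, and these formal sums are divided by
   the congruence generated by commutativity and the bilinearity relations.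
   Scalars need not be kept apart, as they can be absorbed in the u_i. *)
Section Tensor.
Variables (k : fieldType) (U V : lmodType k).

Inductive tensor_eq : seq (U * V) -> seq (U * V) -> Prop :=
| Teq_refl s : tensor_eq s s
| Teq_sym s t : tensor_eq s t -> tensor_eq t s
| Teq_trans s t r : tensor_eq s t -> tensor_eq t r -> tensor_eq s r
| Teq_cat s s' t t' :
    tensor_eq s s' -> tensor_eq t t' -> tensor_eq (s ++ t) (s' ++ t')
| Teq_comm s t : tensor_eq (s ++ t) (t ++ s)
| Teq_addl u u' v : tensor_eq [:: (u + u', v)] [:: (u, v); (u', v)]
| Teq_addr u v v' : tensor_eq [:: (u, v + v')] [:: (u, v); (u, v')]
| Teq_scale a u v : tensor_eq [:: (a *: u, v)] [:: (u, a *: v)]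
| Teq_zero v : tensor_eq [:: (0, v)] [::].

Definition tensor_eqb (s t : seq (U * V)) : bool := `[< tensor_eq s t >].

Lemma tensor_eqb_refl : reflexive tensor_eqb.
Proof. by move=> s; apply/asboolP; exact: Teq_refl. Qed.

Lemma tensor_eqb_sym : symmetric tensor_eqb.
Proof. by move=> s t; apply/asboolP/asboolP; exact: Teq_sym. Qed.

Lemma tensor_eqb_trans : transitive tensor_eqb.
Proof.
by move=> t s r /asboolP st /asboolP tr; apply/asboolP; exact: Teq_trans tr.
Qed.

Canonical tensor_equiv :=
  EquivRel tensor_eqb tensor_eqb_refl tensor_eqb_sym tensor_eqb_trans.

Definition tensor := {eq_quot tensor_eqb}.

HB.instance Definition _ := Choice.on tensor.

Definition tclass (s : seq (U * V)) : tensor := \pi_tensor s.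

Lemma tclassP s t : tclass s = tclass t <-> tensor_eq s t.
Proof.
split=> [/eqmodP /asboolP //|st].
by apply/eqmodP; apply/asboolP.
Qed.

Lemma tclassK (x : tensor) : tclass (repr x) = x.
Proof. exact: reprK. Qed.

Lemma repr_tclass s : tensor_eq (repr (tclass s)) s.
Proof. by apply/tclassP; exact: tclassK. Qed.

Definition sscale (a : k) (s : seq (U * V)) := [seq (a *: p.1, p.2) | p <- s].

Lemma tensor_eq_sscale a s t :
  tensor_eq s t -> tensor_eq (sscale a s) (sscale a t).
Proof.
elim=> {s t} [s|s t _|s t r _ + _|s s' t t' _ + _|s t|u u' v|u v v'|b u v|v].
- exact: Teq_refl.
- exact: Teq_sym.
- exact: Teq_trans.
- by rewrite /sscale !map_cat; exact: Teq_cat.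
- by rewrite /sscale !map_cat; exact: Teq_comm.
- by rewrite /= scalerDr; exact: Teq_addl.
- exact: Teq_addr.
- by rewrite /= scalerA mulrC -scalerA; exact: Teq_scale.
- by rewrite /= scaler0; exact: Teq_zero.
Qed.

Definition tadd (x y : tensor) : tensor := tclass (repr x ++ repr y).
Definition tscale (a : k) (x : tensor) : tensor := tclass (sscale a (repr x)).

Lemma taddE s t : tadd (tclass s) (tclass t) = tclass (s ++ t).
Proof. by apply/tclassP; apply: Teq_cat; exact: repr_tclass. Qed.

Lemma tscaleE a s : tscale a (tclass s) = tclass (sscale a s).
Proof. by apply/tclassP; apply: tensor_eq_sscale; exact: repr_tclass. Qed.

Lemma tensorW (P : tensor -> Prop) : (forall s, P (tclass s)) -> forall x, P x.
Proof. by move=> Ps x; rewrite -(tclassK x). Qed.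

Lemma taddA : associative tadd.
Proof.
elim/tensorW=> s; elim/tensorW=> t; elim/tensorW=> r.
by rewrite !taddE catA.
Qed.

Lemma taddC : commutative tadd.
Proof.
elim/tensorW=> s; elim/tensorW=> t.
by rewrite !taddE; apply/tclassP; exact: Teq_comm.
Qed.

Lemma tadd0 : left_id (tclass [::]) tadd.
Proof. by elim/tensorW=> s; rewrite taddE. Qed.

Lemma sscale_addl a b s : tensor_eq (sscale (a + b) s) (sscale a s ++ sscale b s).
Proof.
elim: s => [|p s IHs]; first exact: Teq_refl.
rewrite /= scalerDl -cat1s.
apply: (@Teq_trans _ ([:: (a *: p.1, p.2); (b *: p.1, p.2)] ++
                      (sscale a s ++ sscale b s))).
  by apply: Teq_cat => //; exact: Teq_addl.
rewrite /= -![_ :: (_ ++ _)]cat1s.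
apply: Teq_cat; first exact: Teq_refl.
rewrite -[_ :: sscale b s]cat1s !catA.
by apply: Teq_cat; [exact: Teq_comm | exact: Teq_refl].
Qed.

Lemma sscale0 s : tensor_eq (sscale 0 s) [::].
Proof.
elim: s => [|p s IHs]; first exact: Teq_refl.
rewrite /= scale0r -cat1s -[X in tensor_eq _ X]cats0.
by apply: Teq_cat => //; exact: Teq_zero.
Qed.

Lemma tscale1 : left_id 1 tscale.
Proof.
elim/tensorW=> s; rewrite tscaleE; congr tclass; rewrite /sscale.
by rewrite -[RHS]map_id; apply: eq_map => -[u v]; rewrite scale1r.
Qed.

Lemma tscaleA a b x : tscale a (tscale b x) = tscale (a * b) x.
Proof.
elim/tensorW: x => s; rewrite !tscaleE; congr tclass.
by rewrite /sscale -map_comp; apply: eq_map => p /=; rewrite scalerA.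
Qed.

Lemma tscaleDr : right_distributive tscale tadd.
Proof.
move=> a; elim/tensorW=> s; elim/tensorW=> t.
by rewrite taddE !tscaleE taddE /sscale map_cat.
Qed.

Lemma tscaleDl x : {morph tscale^~ x : a b / a + b >-> tadd a b}.
Proof.
move=> a b; elim/tensorW: x => s.
by rewrite !tscaleE taddE; apply/tclassP; exact: sscale_addl.
Qed.

Lemma taddN : left_inverse (tclass [::]) (tscale (-1)) tadd.
Proof.
move=> x; rewrite -[x in X in tadd _ X]tscale1 -tscaleDl addNr.
by elim/tensorW: x => s; rewrite tscaleE; apply/tclassP; exact: sscale0.
Qed.

HB.instance Definition _ := GRing.isZmodule.Build tensor taddA taddC tadd0 taddN.
HB.instance Definition _ := GRing.Zmodule_isLmodule.Build k tensor
  tscaleA tscale1 tscaleDr tscaleDl.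

Definition tens (u : U) (v : V) : tensor := tclass [:: (u, v)].

Lemma tens_bilinear : is_bilinear tens.
Proof.
split=> [v a u u'|u a v v'].
- rewrite /= -[a *: tens u v]/(tscale _ _) -[_ + _ in RHS]/(tadd _ _).
  by rewrite tscaleE taddE; apply/tclassP; exact: Teq_addl.
- rewrite /= -[a *: tens u v]/(tscale _ _) -[_ + _ in RHS]/(tadd _ _).
  rewrite tscaleE taddE; apply/tclassP.
  apply: Teq_trans (Teq_addr _ _ _) _; rewrite -[_ :: _]cat1s.
  rewrite -[X in tensor_eq _ X]cat1s.
  by apply: Teq_cat; [exact/Teq_sym/Teq_scale | exact: Teq_refl].
Qed.

Lemma tclass_sum s : tclass s = \sum_(p <- s) tens p.1 p.2.
Proof.
elim: s => [|[u v] s IHs]; first by rewrite big_nil.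
by rewrite big_cons -IHs -[_ + _]/(tadd _ _) taddE.
Qed.

Lemma tensor_sum (x : tensor) : x = \sum_(p <- repr x) tens p.1 p.2.
Proof. by rewrite -tclass_sum tclassK. Qed.

(* The linear map on U (x) V induced by a bilinear map f; a junk value if f is
   not bilinear. *)
Definition tlift (W : lmodType k) (f : U -> V -> W) (x : tensor) : W :=
  \sum_(p <- repr x) f p.1 p.2.

Section Lift.
Variables (W : lmodType k) (f : U -> V -> W).
Hypothesis fB : is_bilinear f.

Lemma bilin0l v : f 0 v = 0.
Proof. by have := fB.1 v (-1) 0 0; rewrite /= scaler0 addr0 scaleN1r addNr. Qed.

Lemma bilin0r u : f u 0 = 0.
Proof. by have := fB.2 u (-1) 0 0; rewrite /= scaler0 addr0 scaleN1r addNr. Qed.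

Lemma bilinZl a u v : f (a *: u) v = a *: f u v.
Proof. by have := fB.1 v a u 0; rewrite /= bilin0l !addr0. Qed.

Lemma bilinZr a u v : f u (a *: v) = a *: f u v.
Proof. by have := fB.2 u a v 0; rewrite /= bilin0r !addr0. Qed.

Lemma bilinDl u u' v : f (u + u') v = f u v + f u' v.
Proof. by have := fB.1 v 1 u u'; rewrite /= !scale1r. Qed.

Lemma bilinDr u v v' : f u (v + v') = f u v + f u v'.
Proof. by have := fB.2 u 1 v v'; rewrite /= !scale1r. Qed.

Lemma tensor_eq_lift s t : tensor_eq s t ->
  \sum_(p <- s) f p.1 p.2 = \sum_(p <- t) f p.1 p.2.
Proof.
elim=> {s t} [//|s t _ ->//|s t r _ -> _ ->//|s s' t t' _ IH _ IH'|s t|||a u v|v].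
- by rewrite !big_cat /= IH IH'.
- by rewrite !big_cat /= addrC.
- by move=> *; rewrite !big_cons !big_nil /= !addr0 bilinDl.
- by move=> *; rewrite !big_cons !big_nil /= !addr0 bilinDr.
- by rewrite !big_cons !big_nil /= bilinZl bilinZr.
- by rewrite big_cons !big_nil /= bilin0l addr0.
Qed.

Lemma tlift_tclass s : tlift f (tclass s) = \sum_(p <- s) f p.1 p.2.
Proof. by apply: tensor_eq_lift; exact: repr_tclass. Qed.

Lemma tlift_tens u v : tlift f (tens u v) = f u v.
Proof. by rewrite tlift_tclass big_seq1. Qed.

Lemma tlift_linear : linear (tlift f).
Proof.
move=> a; elim/tensorW=> s; elim/tensorW=> t.
rewrite -[a *: tclass s]/(tscale _ _) -[tscale _ _ + _]/(tadd _ _).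
rewrite tscaleE taddE !tlift_tclass big_cat big_map scaler_sumr.
by congr (_ + _); apply: eq_bigr => p _; rewrite bilinZl.
Qed.

End Lift.

Lemma tensor_ext (W : lmodType k) (g h : tensor -> W) : linear g -> linear h ->
  (forall u v, g (tens u v) = h (tens u v)) -> g =1 h.
Proof.
move=> gL hL gh x; rewrite [x]tensor_sum.
have lin_sum (f : tensor -> W) : linear f -> forall s,
    f (\sum_(p <- s) tens p.1 p.2) = \sum_(p <- s) f (tens p.1 p.2).
  move=> fL; have f0 : f 0 = 0.
    by have := fL (-1) 0 0; rewrite scaler0 addr0 scaleN1r addNr.
  elim=> [|p s IHs]; first by rewrite !big_nil.
  by rewrite !big_cons -IHs -[X in f (X + _)]scale1r fL scale1r.
by rewrite !lin_sum //; apply: eq_bigr.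
Qed.

End Tensor.

Notation "u \ox v" := (tens u v) (at level 40, left associativity) : ring_scope.

Section TensorMaps.
Variable k : fieldType.

Definition tmap (U U' V V' : lmodType k) (f : U -> U') (g : V -> V') :
    tensor U V -> tensor U' V' :=
  tlift (fun u v => f u \ox g v).

Definition tassoc (U V W : lmodType k) :
    tensor U (tensor V W) -> tensor (tensor U V) W :=
  tlift (fun u => tlift (fun v w => (u \ox v) \ox w)).

Definition tlift3 (U V W X : lmodType k) (f : U -> V -> W -> X) :
    tensor (tensor U V) W -> X :=
  tlift (fun x w => tlift (fun u v => f u v w) x).

Lemma tlift_linear_fun (U V W : lmodType k) (f g : U -> V -> W) a x :
  tlift (fun u v => a *: f u v + g u v) x = a *: tlift f x + tlift g x.
Proof. by rewrite /tlift big_split -scaler_sumr. Qed.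

Lemma eq_tlift (U V W : lmodType k) (f g : U -> V -> W) :
  (forall u v, f u v = g u v) -> tlift f =1 tlift g.
Proof. by move=> fg x; apply: eq_bigr => p _; exact: fg. Qed.

Lemma tmap_bilinear (U U' V V' : lmodType k) (f : U -> U') (g : V -> V') :
  linear f -> linear g -> is_bilinear (fun u v => f u \ox g v).
Proof.
move=> fL gL; split=> [v a u u'|u a v v'] /=.
- by rewrite fL (tens_bilinear _ _).1.
- by rewrite gL (tens_bilinear _ _).2.
Qed.

Lemma tmap_tens (U U' V V' : lmodType k) (f : U -> U') (g : V -> V') u v :
  linear f -> linear g -> tmap f g (u \ox v) = f u \ox g v.
Proof. by move=> fL gL; rewrite [LHS]tlift_tens //; exact: tmap_bilinear. Qed.

Lemma tassoc_bilinear2 (U V W : lmodType k) (u : U) :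
  is_bilinear (fun (v : V) (w : W) => (u \ox v) \ox w).
Proof.
split=> [w a v v'|v a w w'] /=; last by rewrite (tens_bilinear _ _).2.
by rewrite (tens_bilinear _ _).2 (tens_bilinear _ _).1.
Qed.

Lemma tassoc_bilinear (U V W : lmodType k) :
  is_bilinear (fun (u : U) => tlift (fun (v : V) (w : W) => (u \ox v) \ox w)).
Proof.
split=> [x a u u'|u] /=; last exact/tlift_linear/tassoc_bilinear2.
rewrite -tlift_linear_fun; apply: eq_tlift => v w.
by rewrite !(tens_bilinear _ _).1.
Qed.

Lemma tassoc_tens (U V W : lmodType k) (u : U) (v : V) (w : W) :
  tassoc (u \ox (v \ox w)) = (u \ox v) \ox w.
Proof.
rewrite [LHS]tlift_tens; last exact: tassoc_bilinear.
by rewrite tlift_tens //; exact: tassoc_bilinear2.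
Qed.

Lemma tlift3_tens (U V W X : lmodType k) (f : U -> V -> W -> X) u v w :
    (forall w, is_bilinear (fun u v => f u v w)) ->
    (forall u v, linear (f u v)) ->
  tlift3 f (u \ox v \ox w) = f u v w.
Proof.
move=> f12 f3; rewrite [LHS]tlift_tens ?tlift_tens //.
split=> [w'|x a w1 w2] /=; first exact: tlift_linear.
by rewrite -tlift_linear_fun; apply: eq_tlift => u' v'; rewrite f3.
Qed.

End TensorMaps.

(* Unital associative algebras. MathComp's algType is not used because it
   requires 1 != 0: this would exclude the zero algebra, and the tensor product
   of two algebras could not be given its structure without first showing that
   it is not zero. *)
HB.mixin Record isPzAlgebra (k : fieldType) A of GRing.Lmodule k A := {
  aone : A;
  amul : A -> A -> A;
  amul_bilinear : is_bilinear amul;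
  amulA : associative amul;
  amul1l : left_id aone amul;
  amul1r : right_id aone amul
}.
#[short(type="pzAlgType")]
HB.structure Definition PzAlgebra (k : fieldType) :=
  {A of GRing.Lmodule k A & isPzAlgebra k A}.

Notation "x ** y" := (amul x y) (at level 40, left associativity) : ring_scope.

Section TensorAlgebra.
Variables (k : fieldType) (A B : pzAlgType k).

Definition tone : tensor A B := aone \ox aone.

Definition tmul (x y : tensor A B) : tensor A B :=
  tlift (fun a b => tlift (fun a' b' => (a ** a') \ox (b ** b')) y) x.

Lemma tmul_bilinear2 (a : A) (b : B) :
  is_bilinear (fun a' b' => (a ** a') \ox (b ** b')).
Proof.
split=> [b' c x y|a' c x y] /=.
- by rewrite (amul_bilinear (s := A)).2 (tens_bilinear _ _).1.
- by rewrite (amul_bilinear (s := B)).2 (tens_bilinear _ _).2.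
Qed.

Lemma tmul_bilinear1 (y : tensor A B) :
  is_bilinear (fun a b => tlift (fun a' b' => (a ** a') \ox (b ** b')) y).
Proof.
split=> [b c a a'|a c b b'] /=;
  rewrite -tlift_linear_fun; apply: eq_tlift => u v.
- by rewrite (amul_bilinear (s := A)).1 (tens_bilinear _ _).1.
- by rewrite (amul_bilinear (s := B)).1 (tens_bilinear _ _).2.
Qed.

Lemma tmul_tens a b a' b' :
  tmul (a \ox b) (a' \ox b') = (a ** a') \ox (b ** b').
Proof.
rewrite /tmul tlift_tens; last exact: tmul_bilinear1.
by rewrite tlift_tens //; exact: tmul_bilinear2.
Qed.

Lemma tmul_bilinear : is_bilinear tmul.
Proof.
split=> [y|x c y y'] /=; first exact/tlift_linear/tmul_bilinear1.
rewrite /tmul -tlift_linear_fun; apply: eq_tlift => a b.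
by rewrite (tlift_linear (tmul_bilinear2 _ _)).
Qed.

Let tmulA : associative tmul.
Proof.
move=> x y z; move: x; apply: tensor_ext => [c x x'|c x x'|a b].
- exact: tmul_bilinear.1.
- by rewrite !(bilinDl tmul_bilinear, bilinZl tmul_bilinear).
move: y; apply: tensor_ext => [c y y'|c y y'|a' b'].
- by rewrite !(bilinDl tmul_bilinear, bilinZl tmul_bilinear,
               bilinDr tmul_bilinear, bilinZr tmul_bilinear).
- by rewrite !(bilinDl tmul_bilinear, bilinZl tmul_bilinear,
               bilinDr tmul_bilinear, bilinZr tmul_bilinear).
move: z; apply: tensor_ext => [c z z'|c z z'|a'' b''].
- by rewrite !(bilinDr tmul_bilinear, bilinZr tmul_bilinear).
- by rewrite !(bilinDr tmul_bilinear, bilinZr tmul_bilinear).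
by rewrite !tmul_tens !amulA.
Qed.

Let tmul1l : left_id tone tmul.
Proof.
apply: tensor_ext => [c x x'|//|a b].
- exact: tmul_bilinear.2.
- by rewrite tmul_tens !amul1l.
Qed.

Let tmul1r : right_id tone tmul.
Proof.
apply: tensor_ext => [c x x'|//|a b].
- exact: tmul_bilinear.1.
- by rewrite tmul_tens !amul1r.
Qed.

HB.instance Definition _ := isPzAlgebra.Build k (tensor A B)
  tmul_bilinear tmulA tmul1l tmul1r.

Lemma amul_tens (a a' : A) (b b' : B) :
  (a \ox b) ** (a' \ox b') = (a ** a') \ox (b ** b').
Proof. exact: tmul_tens. Qed.

End TensorAlgebra.

(* Sweedler sums: an expression f(x_1, x_2) is tlift f (comul x). The triple
   tensor power is (C (x) C) (x) C, and elements of C (x) (C (x) C) are carried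
   to it by tassoc. *)
HB.mixin Record isCoalgebra (k : fieldType) C of GRing.Lmodule k C := {
  comul : {linear C -> tensor C C};
  counit : {scalar C};
  coassoc : forall x, tmap comul id (comul x) = tassoc (tmap id comul (comul x));
  counitl : forall x, tlift (fun a b => counit a *: b) (comul x) = x;
  counitr : forall x, tlift (fun a b => counit b *: a) (comul x) = x
}.
#[short(type="coalgType")]
HB.structure Definition Coalgebra (k : fieldType) :=
  {C of GRing.Lmodule k C & isCoalgebra k C}.

Definition comul2 (k : fieldType) (C : coalgType k) (x : C) :
    tensor (tensor C C) C :=
  tmap comul id (comul x).

(* The product of (H (x) H) (x) H in the last two fields is the one of the
   tensor product of algebras; k^o is k as a vector space over itself. *)
HB.mixin Record isWeakBialgebra (k : fieldType) H
    of PzAlgebra k H & Coalgebra k H := {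
  comulM : forall x y : H, comul (x ** y) = comul x ** comul y;
  counitM12 : forall x y z : H, counit (x ** y ** z) =
    tlift (fun a b => counit (x ** a) * counit (b ** z) : k^o) (comul y);
  counitM21 : forall x y z : H, counit (x ** y ** z) =
    tlift (fun a b => counit (x ** b) * counit (a ** z) : k^o) (comul y);
  comul2_1l : comul2 (aone : H) =
    (comul (aone : H) \ox (aone : H)) ** tassoc ((aone : H) \ox comul (aone : H));
  comul2_1r : comul2 (aone : H) =
    tassoc ((aone : H) \ox comul (aone : H)) ** (comul (aone : H) \ox (aone : H))
}.
#[short(type="weakBialgType")]
HB.structure Definition WeakBialgebra (k : fieldType) :=
  {H of PzAlgebra k H & Coalgebra k H & isWeakBialgebra k H}.

Section WeakBialgebraTheory.
Variables (k : fieldType) (H : weakBialgType k).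

Definition PiL (h : H) : H :=
  tlift (fun a b => counit (a ** h) *: b) (comul aone).

Definition PiR (h : H) : H :=
  tlift (fun a b => counit (h ** b) *: a) (comul aone).

Definition quantum_commutative : Prop :=
  forall h g : H, tlift (fun a b => a ** g ** PiR b) (comul h) = h ** g.

Lemma PiL_linear : linear PiL.
Proof.
move=> c x y; rewrite /PiL -tlift_linear_fun; apply: eq_tlift => a b.
by rewrite (amul_bilinear (s := H)).2 linearP scalerDl scalerA.
Qed.

Lemma PiR_linear : linear PiR.
Proof.
move=> c x y; rewrite /PiR -tlift_linear_fun; apply: eq_tlift => a b.
by rewrite (amul_bilinear (s := H)).1 linearP scalerDl scalerA.
Qed.

HB.instance Definition _ :=
  GRing.isLinear.Build k H H *:%R PiL PiL_linear.
HB.instance Definition _ :=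
  GRing.isLinear.Build k H H *:%R PiR PiR_linear.

End WeakBialgebraTheory.

Arguments quantum_commutative {k} H.

HB.mixin Record hasAntipode (k : fieldType) H of WeakBialgebra k H := {
  antipode : {linear H -> H};
  antipodeL : forall x : H, tlift (fun a b => a ** antipode b) (comul x) = PiL x;
  antipodeR : forall x : H, tlift (fun a b => antipode a ** b) (comul x) = PiR x;
  antipode_conv : forall x : H,
    tlift3 (fun a b c => antipode a ** b ** antipode c) (comul2 x) = antipode x
}.
#[short(type="weakHopfAlgType")]
HB.structure Definition WeakHopfAlgebra (k : fieldType) :=
  {H of WeakBialgebra k H & hasAntipode k H}.

Definition adjoint_action (k : fieldType) (H : weakHopfAlgType k) (h x : H) : H :=
  tlift (fun a b => a ** x ** antipode b) (comul h).

Section RotaBaxter.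
Variables (k : fieldType) (B : pzAlgType k) (M : lmodType k).

Definition left_module (act : B -> M -> M) : Prop :=
  [/\ is_bilinear act,
      forall m, act aone m = m
    & forall a b m, act (a ** b) m = act a (act b m)].

Definition rota_baxter_paired_module (lam : k) (act : B -> M -> M)
    (P : B -> B) (T : M -> M) : Prop :=
  [/\ left_module act, linear P, linear T
    & forall b m, act (P b) (T m) =
        T (act (P b) m) + T (act b (T m)) + lam *: T (act b m)].

End RotaBaxter.

(* Main.v *)
(* Write H_L and H_R for the images of PiL and PiR. They commute, elements z of
   H_L satisfy Delta(z) = z 1_1 (x) 1_2 = 1_1 z (x) 1_2, dually for H_R, and the
   antipode is antimultiplicative and coincides with PiR on H_L. Quantum
   commutativity at h = 1 then says that 1_H acts as the identity, so that
   elements of H_L act by left multiplication; at h in H_R, it says that H_R is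
   central. As Delta(1) lies in H_R (x) H_L, centrality gives
   PiL(x) = eps(x 1_1) 1_2, hence eps(xy) = eps(PiL(x) y), and PiL(xyz) depends
   on y only through PiL(y). Thus PiL(b . PiL(m)) = PiL(b . m), and the identity
   reduces to PiL(PiL(b) m) = PiL(b) PiL(m). *)

Require Import Defs.
From mathcomp Require Import all_boot all_algebra.
Import GRing.Theory.
Local Open Scope ring_scope.

Set Implicit Arguments.
Unset Strict Implicit.
Unset Printing Implicit Defensive.

Local Notation "\sw_ ( a , b <- x ) E" := (tlift (fun a b => E) (comul x))
  (at level 41, E at level 41, a name, b name, x at level 50,
   format "\sw_ ( a ,  b  <-  x )  E") : ring_scope.

(** * Calculus of lifts of multilinear maps to tensor products *)

Section Multilinear.
Variable k : fieldType.
Implicit Types U V W X : lmodType k.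

Lemma bilinearI U V W (F : U -> V -> W) :
  (forall v, linear (fun u => F u v)) -> (forall u, linear (fun v => F u v)) ->
  is_bilinear F.
Proof. by []. Qed.

Lemma linear_bilinl U V W X (F : V -> W -> X) (f : U -> V) w :
  is_bilinear F -> linear f -> linear (fun u => F (f u) w).
Proof. by move=> FB fL c x y; rewrite fL; exact: FB.1. Qed.

Lemma linear_bilinr U V W X (F : V -> W -> X) (f : U -> W) v :
  is_bilinear F -> linear f -> linear (fun u => F v (f u)).
Proof. by move=> FB fL c x y; rewrite fL; exact: FB.2. Qed.

Definition is_trilinear U V W X (F : U -> V -> W -> X) : Prop :=
  [/\ forall v w, linear (fun u => F u v w),
      forall u w, linear (fun v => F u v w)
    & forall u v, linear (fun w => F u v w)].

Lemma linear_id U : linear (fun u : U => u).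
Proof. by []. Qed.

Lemma linear_comp U V W (f : V -> W) (g : U -> V) :
  linear f -> linear g -> linear (fun u => f (g u)).
Proof. by move=> fL gL c x y; rewrite gL fL. Qed.

Lemma linear_scaler U V (c : k) (f : U -> V) :
  linear f -> linear (fun u => c *: f u).
Proof. by move=> fL d x y; rewrite fL scalerDr !scalerA mulrC. Qed.

Lemma linear_counitl U (C : coalgType k) V (f : U -> C) (v : V) :
  linear f -> linear (fun u => counit (f u) *: v).
Proof. by move=> fL c x y; rewrite fL linearP scalerDl scalerA. Qed.

Lemma linear_amull U (A : pzAlgType k) (f : U -> A) y :
  linear f -> linear (fun u => f u ** y).
Proof. by move=> fL c u v; rewrite fL (amul_bilinear (s := A)).1. Qed.

Lemma linear_amulr U (A : pzAlgType k) (f : U -> A) y :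
  linear f -> linear (fun u => y ** f u).
Proof. by move=> fL c u v; rewrite fL (amul_bilinear (s := A)).2. Qed.

Lemma linear_tlift U V W X (F : U -> V -> W -> X) t :
  (forall v w, linear (fun u => F u v w)) -> linear (fun u => tlift (F u) t).
Proof.
move=> FL c x y; rewrite -tlift_linear_fun.
by apply: eq_tlift => v w; rewrite FL.
Qed.

Lemma linear_sw U (C : coalgType k) V (F : C -> C -> V) (f : U -> C) :
  is_bilinear F -> linear f -> linear (fun u => \sw_(a, b <- f u) F a b).
Proof.
by move=> FB fL c x y; rewrite fL linearP; exact: (tlift_linear FB).
Qed.

Lemma linear_map0 U V (L : U -> V) : linear L -> L 0 = 0.
Proof.
by move=> LL; have := LL (-1) 0 0; rewrite scaler0 addr0 scaleN1r addNr.
Qed.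

Lemma linear_mapZ U V (L : U -> V) : linear L ->
  forall c x, L (c *: x) = c *: L x.
Proof.
by move=> LL c x; have := LL c x 0; rewrite !addr0 linear_map0 // addr0.
Qed.

(** [tlift] is a finite sum over a chosen representative of [t], so a linear map passes through it
    term by term. *)
Lemma linear_tliftE U V W X (L : W -> X) : linear L ->
  forall (F : U -> V -> W) t, L (tlift F t) = tlift (fun u v => L (F u v)) t.
Proof.
move=> LL F t; rewrite /tlift; apply: (big_morph L _ (linear_map0 LL)) => x y.
by have := LL 1 x y; rewrite !scale1r.
Qed.

Lemma exchange_tlift U V U' V' W (F : U -> V -> U' -> V' -> W) s t :
  tlift (fun u v => tlift (fun u' v' => F u v u' v') t) s =
  tlift (fun u' v' => tlift (fun u v => F u v u' v') s) t.
Proof. exact: exchange_big. Qed.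

Lemma scale_tlift U V W (c : k) (F : U -> V -> W) t :
  c *: tlift F t = tlift (fun u v => c *: F u v) t.
Proof. exact: scaler_sumr. Qed.

Lemma tlift_amul U V (A : pzAlgType k) (F : U -> V -> A) t y :
  tlift F t ** y = tlift (fun u v => F u v ** y) t.
Proof. exact/(linear_tliftE (L := fun x => x ** y))/linear_amull/linear_id. Qed.

Lemma amul_tlift U V (A : pzAlgType k) (F : U -> V -> A) t y :
  y ** tlift F t = tlift (fun u v => y ** F u v) t.
Proof. exact/(linear_tliftE (L := fun x => y ** x))/linear_amulr/linear_id. Qed.

Lemma tlift_tmap U V U' V' W (F : U' -> V' -> W) (f : U -> U') (g : V -> V') :
  is_bilinear F -> linear f -> linear g -> forall t,
  tlift F (tmap f g t) = tlift (fun u v => F (f u) (g v)) t.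
Proof.
move=> FB fL gL t; rewrite /tmap (linear_tliftE (tlift_linear FB)).
by apply: eq_tlift => u v; rewrite tlift_tens.
Qed.

Lemma tlift3_bilinear U V W X (F : U -> V -> W -> X) : is_trilinear F ->
  is_bilinear (fun t w => tlift (fun u v => F u v w) t).
Proof.
move=> [F1 F2 F3]; split=> [w|t]; last exact: linear_tlift.
by apply: tlift_linear; split=> [v|u]; [exact: F1|exact: F2].
Qed.

Lemma tlift3_tassoc U V W X (F : U -> V -> W -> X) t : is_trilinear F ->
  tlift3 F (tassoc t) = tlift (fun u => tlift (F u)) t.
Proof.
move=> FT; have TB := tlift3_bilinear FT; case: FT => F1 F2 F3.
rewrite /tlift3 /tassoc (linear_tliftE (tlift_linear TB)).
apply: eq_tlift => u s; rewrite (linear_tliftE (tlift_linear TB)).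
by apply: eq_tlift => v w; rewrite !tlift_tens.
Qed.

Lemma tliftK U V (t : tensor U V) : t = tlift (@tens k U V) t.
Proof. exact: tensor_sum. Qed.

Lemma tlift_mul (A B : pzAlgType k) W (F : A -> B -> W) (s t : tensor A B) :
  is_bilinear F ->
  tlift F (s ** t) =
  tlift (fun a b => tlift (fun c d => F (a ** c) (b ** d)) t) s.
Proof.
move=> FB; rewrite [_ ** _]/(tmul _ _) /tmul.
rewrite (linear_tliftE (tlift_linear FB)); apply: eq_tlift => a b.
rewrite (linear_tliftE (tlift_linear FB)); apply: eq_tlift => c d.
by rewrite tlift_tens.
Qed.

Section Legs.
Variables (A : pzAlgType k) (s t : tensor A A).

Let legs12 : s \ox (aone : A) = tlift (fun a b => a \ox b \ox (aone : A)) s.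
Proof.
rewrite [in LHS](tliftK s) (linear_tliftE (L := fun x => x \ox (aone : A))) //.
exact: (tens_bilinear _ _).1.
Qed.

Let legs23 :
  tassoc ((aone : A) \ox t) = tlift (fun c d => (aone : A) \ox c \ox d) t.
Proof.
by rewrite [LHS]tlift_tens //; exact: tassoc_bilinear.
Qed.

(** Only the middle legs interact: (a (x) b (x) 1)(1 (x) c (x) d) = a (x) bc (x) d. This evaluates
    the axioms on Delta^2(1). *)
Lemma tlift3_legsl W (F : A -> A -> A -> W) : is_trilinear F ->
  tlift3 F ((s \ox (aone : A)) ** tassoc ((aone : A) \ox t)) =
  tlift (fun a b => tlift (fun c d => F a (b ** c) d) t) s.
Proof.
move=> FT; have TL : linear (tlift3 F) := tlift_linear (tlift3_bilinear FT).
rewrite legs12 legs23 tlift_amul (linear_tliftE TL); apply: eq_tlift => a b.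
rewrite amul_tlift (linear_tliftE TL); apply: eq_tlift => c d.
by case: FT => F1 F2 F3; rewrite !amul_tens amul1l amul1r tlift3_tens.
Qed.

Lemma tlift3_legsr W (F : A -> A -> A -> W) : is_trilinear F ->
  tlift3 F (tassoc ((aone : A) \ox t) ** (s \ox (aone : A))) =
  tlift (fun a b => tlift (fun c d => F a (c ** b) d) t) s.
Proof.
move=> FT; have TL : linear (tlift3 F) := tlift_linear (tlift3_bilinear FT).
rewrite legs12 legs23 amul_tlift (linear_tliftE TL); apply: eq_tlift => a b.
rewrite tlift_amul (linear_tliftE TL); apply: eq_tlift => c d.
by case: FT => F1 F2 F3; rewrite !amul_tens amul1l amul1r tlift3_tens.
Qed.

End Legs.

End Multilinear.

(** Peels a linearity side condition one constructor at a time; an abstract map is handled through a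
    bilinearity hypothesis in the context. *)
Ltac multilin :=
  repeat first
  [ exact: linear_id
  | apply: bilinearI => ?
  | match goal with |- is_trilinear _ => split => ? ? end
  | match goal with H : bilinear_for _ _ _ |- _ =>
      first [apply: (linear_bilinl _ H) | apply: (linear_bilinr _ H)] end
  | apply: linear_counitl
  | apply: linear_scaler
  | apply: linear_amull
  | apply: linear_amulr
  | apply: linear_tlift => ? ?
  | apply: linear_sw
  | apply: (linear_comp (f := antipode)); [exact: linearP|]
  | apply: (linear_comp (f := @PiL _ _)); [exact: linearP|]
  | apply: (linear_comp (f := @PiR _ _)); [exact: linearP|] ].

(** * Sweedler calculus in a coalgebra *)

Section Sweedler.
Variable k : fieldType.

Section Coalgebra.
Variables (C : coalgType k) (W : lmodType k).

Lemma sw_coassoc (F : C -> C -> C -> W) x : is_trilinear F ->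
  \sw_(a, b <- x) \sw_(c, d <- a) F c d b =
  \sw_(a, b <- x) \sw_(c, d <- b) F a c d.
Proof.
move=> FT; have TB := tlift3_bilinear FT.
have comulL : linear (comul : C -> tensor C C) by exact: linearP.
have := congr1 (tlift3 F) (coassoc x).
rewrite tlift3_tassoc // [LHS](tlift_tmap TB) // => ->.
case: FT => F1 F2 F3; rewrite (tlift_tmap (F := fun u t => tlift (F u) t)) //.
split=> [t|u]; first exact: linear_tlift.
by apply: tlift_linear; split=> ?; [exact: F2|exact: F3].
Qed.

Lemma sw_counitr (f : C -> W) x : linear f ->
  \sw_(a, b <- x) counit b *: f a = f x.
Proof.
move=> fL; rewrite -[in RHS](counitr x) linear_tliftE //.
by apply: eq_tlift => a b; rewrite linear_mapZ.
Qed.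

End Coalgebra.

(** * The counital maps of a weak bialgebra *)

Section WeakBialgebra.
Variable H : weakBialgType k.
Implicit Types (x y z u v : H) (W : lmodType k).

Lemma sw_amul W (F : H -> H -> W) x y : is_bilinear F ->
  \sw_(p, q <- x ** y) F p q =
  \sw_(a, b <- x) \sw_(c, d <- y) F (a ** c) (b ** d).
Proof. by rewrite comulM; exact: tlift_mul. Qed.

(** The counit occurs below only as a coefficient; keeping the vector [w] makes the axiom a rewrite
    rule inside sums. *)
Lemma counit_sw12 W x y z (w : W) : counit (x ** y ** z) *: w =
  \sw_(a, b <- y) counit (x ** a) *: (counit (b ** z) *: w).
Proof.
rewrite counitM12 (linear_tliftE (L := fun c : k^o => c *: w)).
  by apply: eq_tlift => a b; rewrite scalerA.
by move=> c p q; rewrite scalerDl -scalerA.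
Qed.

Lemma counit_sw21 W x y z (w : W) : counit (x ** y ** z) *: w =
  \sw_(a, b <- y) counit (x ** b) *: (counit (a ** z) *: w).
Proof.
rewrite counitM21 (linear_tliftE (L := fun c : k^o => c *: w)).
  by apply: eq_tlift => a b; rewrite scalerA.
by move=> c p q; rewrite scalerDl -scalerA.
Qed.

Lemma sw_comul1l W (F : H -> H -> H -> W) : is_trilinear F ->
  \sw_(a, b <- aone) \sw_(c, d <- a) F c d b =
  \sw_(a, b <- aone) \sw_(c, d <- aone) F a (b ** c) d.
Proof.
move=> FT; have TB := tlift3_bilinear FT.
have comulL : linear (comul : H -> tensor H H) by exact: linearP.
have := congr1 (tlift3 F) comul2_1l.
by rewrite [LHS](tlift_tmap TB) // => ->; exact: tlift3_legsl.
Qed.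

Lemma sw_comul1r W (F : H -> H -> H -> W) : is_trilinear F ->
  \sw_(a, b <- aone) \sw_(c, d <- a) F c d b =
  \sw_(a, b <- aone) \sw_(c, d <- aone) F a (c ** b) d.
Proof.
move=> FT; have TB := tlift3_bilinear FT.
have comulL : linear (comul : H -> tensor H H) by exact: linearP.
have := congr1 (tlift3 F) comul2_1r.
by rewrite [LHS](tlift_tmap TB) // => ->; exact: tlift3_legsr.
Qed.

Local Notation one := (aone : H).

Lemma PiLE W (f : H -> W) x : linear f ->
  f (PiL x) = \sw_(a, b <- one) counit (a ** x) *: f b.
Proof.
move=> fL; rewrite /PiL (linear_tliftE fL).
by apply: eq_tlift => a b; rewrite linear_mapZ.
Qed.

Lemma PiRE W (f : H -> W) x : linear f ->
  f (PiR x) = \sw_(a, b <- one) counit (x ** b) *: f a.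
Proof.
move=> fL; rewrite /PiR (linear_tliftE fL).
by apply: eq_tlift => a b; rewrite linear_mapZ.
Qed.

(** * Coproducts of elements in the images of [PiL] and [PiR] *)

Section Comul.
Variables (W : lmodType k) (F : H -> H -> W).
Hypothesis FB : is_bilinear F.

Let PiL_coassoc x : \sw_(a, b <- PiL x) F a b =
  \sw_(p, q <- one) \sw_(c, d <- p) counit (c ** x) *: F d q.
Proof.
rewrite (PiLE (f := fun y => \sw_(a, b <- y) F a b)); last by multilin.
rewrite (sw_coassoc (F := fun a b c => counit (a ** x) *: F b c));
  last by multilin.
by apply: eq_tlift => a b; rewrite scale_tlift.
Qed.

(** Coassociativity gives Delta(PiL x) = eps(1_1 x) 1_2 (x) 1_3. Splitting Delta^2(1) by
    [sw_comul1l] leaves PiL x in front of a second copy of Delta(1); [sw_comul1r] puts it behind 1_1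
    instead. *)
Lemma sw_PiL_mull x :
  \sw_(a, b <- PiL x) F a b = \sw_(a, b <- one) F (PiL x ** a) b.
Proof.
rewrite PiL_coassoc (sw_comul1l (F := fun a b c => counit (a ** x) *: F b c));
  last by multilin.
rewrite exchange_tlift; apply: eq_tlift => c d.
by rewrite (PiLE (f := fun z => F (z ** c) d)) //; multilin.
Qed.

Lemma sw_PiL_mulr x :
  \sw_(a, b <- PiL x) F a b = \sw_(a, b <- one) F (a ** PiL x) b.
Proof.
rewrite PiL_coassoc (sw_comul1r (F := fun a b c => counit (a ** x) *: F b c));
  last by multilin.
rewrite exchange_tlift; apply: eq_tlift => c d.
by rewrite (PiLE (f := fun z => F (c ** z) d)) //; multilin.
Qed.

Let PiR_coassoc x : \sw_(a, b <- PiR x) F a b =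
  \sw_(p, q <- one) \sw_(c, d <- p) counit (x ** q) *: F c d.
Proof.
rewrite (PiRE (f := fun y => \sw_(a, b <- y) F a b)); last by multilin.
by apply: eq_tlift => a b; rewrite scale_tlift.
Qed.

Lemma sw_PiR_mulr x :
  \sw_(a, b <- PiR x) F a b = \sw_(a, b <- one) F a (b ** PiR x).
Proof.
rewrite PiR_coassoc (sw_comul1l (F := fun a b c => counit (x ** c) *: F a b));
  last by multilin.
apply: eq_tlift => a b.
by rewrite (PiRE (f := fun z => F a (b ** z))) //; multilin.
Qed.

Lemma sw_PiR_mull x :
  \sw_(a, b <- PiR x) F a b = \sw_(a, b <- one) F a (PiR x ** b).
Proof.
rewrite PiR_coassoc (sw_comul1r (F := fun a b c => counit (x ** c) *: F a b));
  last by multilin.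
apply: eq_tlift => a b.
by rewrite (PiRE (f := fun z => F a (z ** b))) //; multilin.
Qed.

End Comul.

(** Delta(PiL y) = Delta(1)(PiL y (x) 1), and Delta(x) absorbs Delta(1). *)
Lemma sw_amul_PiL W (F : H -> H -> W) x y : is_bilinear F ->
  \sw_(a, b <- x ** PiL y) F a b = \sw_(a, b <- x) F (a ** PiL y) b.
Proof.
move=> FB; rewrite sw_amul // -[in RHS](amul1r x) sw_amul; last by multilin.
apply: eq_tlift => a b; rewrite sw_PiL_mulr; last by multilin.
by apply: eq_tlift => c d; rewrite amulA.
Qed.

Lemma sw_PiR_amul W (F : H -> H -> W) x y : is_bilinear F ->
  \sw_(a, b <- PiR x ** y) F a b = \sw_(a, b <- y) F a (PiR x ** b).
Proof.
move=> FB; rewrite sw_amul // -[in RHS](amul1l y) sw_amul; last by multilin.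
rewrite sw_PiR_mull; last by multilin.
by apply: eq_tlift => a b; apply: eq_tlift => c d; rewrite amulA.
Qed.

(** Axiom (ii) with the unit in the middle: eps(x 1 y) = eps(x 1_2) eps(1_1 y), where eps(1_1 y) 1_2
    is PiL y. *)
Lemma counit_PiLr W x y (w : W) :
  counit (x ** PiL y) *: w = counit (x ** y) *: w.
Proof.
rewrite -[in RHS](amul1r x) counit_sw21.
rewrite (PiLE (f := fun v => counit (x ** v) *: w)); last by multilin.
by apply: eq_tlift => a b; rewrite !scalerA mulrC.
Qed.

Lemma counit_PiRl W x y (w : W) :
  counit (PiR x ** y) *: w = counit (x ** y) *: w.
Proof.
rewrite -[in RHS](amul1r x) counit_sw21.
by rewrite (PiRE (f := fun v => counit (v ** y) *: w)); last by multilin.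
Qed.

Lemma PiL_amul_PiL x y : PiL (x ** PiL y) = PiL (x ** y).
Proof. by apply: eq_tlift => a b; rewrite !amulA counit_PiLr. Qed.

Lemma PiR_PiR_amul x y : PiR (PiR x ** y) = PiR (x ** y).
Proof. by apply: eq_tlift => a b; rewrite -!amulA counit_PiRl. Qed.

(** Applying eps(- x) (x) id (x) eps(y -) to the two factorizations of Delta^2(1) yields the two
    products. *)
Lemma PiL_PiR_comm x y : PiL x ** PiR y = PiR y ** PiL x.
Proof.
have FT :
    is_trilinear (fun a m d : H => counit (a ** x) *: (counit (y ** d) *: m)).
  by multilin.
rewrite (PiLE (f := fun z => z ** PiR y)); last by multilin.
rewrite (PiLE (f := fun z => PiR y ** z)); last by multilin.
have := sw_comul1r FT; rewrite sw_comul1l // => E.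
etransitivity; last etransitivity; [|exact: E|]; apply: eq_tlift => a b.
  rewrite (PiRE (f := fun z => b ** z)); last by multilin.
  by rewrite scale_tlift.
rewrite (PiRE (f := fun z => z ** b)); last by multilin.
by rewrite scale_tlift.
Qed.

(** By [PiL_amul_PiL] it suffices that [PiL] fixes z = PiL x PiL y. As Delta(z) = 1_1 z (x) 1_2, the
    counit law gives z = eps(1_1 z) 1_2. *)
Lemma PiL_PiL_amul x y : PiL (PiL x ** y) = PiL x ** PiL y.
Proof.
rewrite -PiL_amul_PiL -[RHS](counitl) sw_amul_PiL; last by multilin.
rewrite sw_PiL_mulr; last by multilin.
by apply: eq_tlift => a b; rewrite amulA.
Qed.

Lemma PiR_amul_PiR x y : PiR (x ** PiR y) = PiR x ** PiR y.
Proof.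
rewrite -PiR_PiR_amul -[RHS](counitr) sw_PiR_amul; last by multilin.
rewrite sw_PiR_mull; last by multilin.
by apply: eq_tlift => a b; rewrite amulA.
Qed.

Lemma PiR1 : PiR one = one.
Proof.
rewrite -[RHS]counitr; by apply: eq_tlift => a b; rewrite amul1l.
Qed.

(** PiL(1_2) brings in a second copy of Delta(1); the product 1'_1 1_2 is then the middle leg of
    Delta^2(1), where the counit erases it. *)
Lemma sw1_PiL W (F : H -> H -> W) : is_bilinear F ->
  \sw_(a, b <- one) F a (PiL b) = \sw_(a, b <- one) F a b.
Proof.
move=> FB; transitivity
  (\sw_(a, b <- one) \sw_(c, d <- one) counit (c ** b) *: F a d).
  by apply: eq_tlift => a b; rewrite PiLE //; multilin.
rewrite -(sw_comul1r (F := fun a m d => counit m *: F a d)); last by multilin.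
by apply: eq_tlift => a b;
   rewrite (sw_counitr (f := fun c => F c b)) //; multilin.
Qed.

Lemma sw1_PiR W (F : H -> H -> W) : is_bilinear F ->
  \sw_(a, b <- one) F (PiR a) b = \sw_(a, b <- one) F a b.
Proof.
move=> FB; transitivity
  (\sw_(a, b <- one) \sw_(c, d <- one) counit (a ** d) *: F c b).
  apply: eq_tlift => a b.
  by rewrite (PiRE (f := fun z => F z b)) //; multilin.
(* The copies of Delta(1) are swapped to match the order of the middle product in [sw_comul1r]. *)
rewrite exchange_tlift.
rewrite -(sw_comul1r (F := fun a m d => counit m *: F a d)); last by multilin.
by apply: eq_tlift => a b;
   rewrite (sw_counitr (f := fun c => F c b)) //; multilin.
Qed.

(** * Quantum commutative weak bialgebras *)

Section QuantumCommutative.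
Hypothesis Hqc : quantum_commutative H.

(** For z = PiR x, Delta(z) = 1_1 (x) 1_2 z turns zy = z_1 y PiR(z_2) into 1_1 y PiR(1_2) z, which
    is yz by quantum commutativity at the unit. *)
Lemma qc_PiR_central x y : PiR x ** y = y ** PiR x.
Proof.
rewrite -Hqc sw_PiR_mulr; last by multilin.
rewrite -[in RHS](amul1l y) -(Hqc one y) tlift_amul.
by apply: eq_tlift => a b; rewrite PiR_amul_PiR !amulA.
Qed.

(** The leg 1_1 may be replaced by PiR(1_1), which is central. *)
Lemma qc_PiLE W (f : H -> W) x : linear f ->
  f (PiL x) = \sw_(a, b <- one) counit (x ** a) *: f b.
Proof.
move=> fL; rewrite PiLE //.
have FB : is_bilinear (fun a b => counit (a ** x) *: f b).
  by multilin.
have FB' : is_bilinear (fun a b => counit (x ** a) *: f b).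
  by multilin.
rewrite -(sw1_PiR FB) -(sw1_PiR FB').
by apply: eq_tlift => a b; rewrite qc_PiR_central.
Qed.

(** The other half of axiom (ii), eps(x 1 y) = eps(x 1_1) eps(1_2 y), meets [PiL] in the form given
    by [qc_PiLE]. *)
Lemma qc_counit_PiLl W x y (w : W) :
  counit (PiL x ** y) *: w = counit (x ** y) *: w.
Proof.
rewrite -[in RHS](amul1r x) counit_sw12.
by rewrite (qc_PiLE (f := fun v => counit (v ** y) *: w)); last by multilin.
Qed.

(** Under the counit, [PiL] can be wrapped around 1_1 x PiL(y), where it absorbs the inner [PiL],
    and then be removed. *)
Lemma qc_PiL_amul_mid x y z : PiL (x ** PiL y ** z) = PiL (x ** y ** z).
Proof.
apply: eq_tlift => a b; rewrite !amulA -qc_counit_PiLl -[RHS]qc_counit_PiLl.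
by rewrite PiL_amul_PiL.
Qed.

End QuantumCommutative.

End WeakBialgebra.

(** * The antipode and the adjoint action *)

Section WeakHopfAlgebra.
Variable H : weakHopfAlgType k.
Implicit Types x y z : H.
Local Notation one := (aone : H).
Local Notation S := (antipode : H -> H).

Lemma antipode_sw x : S x = \sw_(p, q <- x) \sw_(a, b <- p) S a ** b ** S q.
Proof.
rewrite -[LHS]antipode_conv [LHS](tlift_tmap) //; last by exact: linearP.
by apply: tlift3_bilinear; multilin.
Qed.

(** In S(x_1) x_2 S(x_3) the last two factors form [PiL]. *)
Lemma antipode_PiL_r x : S x = \sw_(a, b <- x) S a ** PiL b.
Proof.
rewrite antipode_sw (sw_coassoc (F := fun a b c => S a ** b ** S c));
  last by multilin.
apply: eq_tlift => a b; rewrite -antipodeL amul_tlift.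
by apply: eq_tlift => c d; rewrite amulA.
Qed.

Lemma antipode_PiR_l x : S x = \sw_(a, b <- x) PiR a ** S b.
Proof.
by rewrite antipode_sw; apply: eq_tlift => a b; rewrite -antipodeR tlift_amul.
Qed.

(** After [y] is replaced by PiL y, the coproduct of x PiL(y) carries it in the first leg only. *)
Lemma PiL_amulE x y : PiL (x ** y) = \sw_(a, b <- x) a ** PiL y ** S b.
Proof.
by rewrite -PiL_amul_PiL -antipodeL sw_amul_PiL; last by multilin.
Qed.

Lemma PiR_amulE x y : PiR (x ** y) = \sw_(a, b <- y) S a ** PiR x ** b.
Proof.
rewrite -PiR_PiR_amul -antipodeR sw_PiR_amul; last by multilin.
by apply: eq_tlift => a b; rewrite amulA.
Qed.

(* S(xy) = S(x_1 y_1) PiL(x_2 y_2) = S(x_1 y_1) x_2 y_2 S(y_3) S(x_3)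
   = PiR(x_1 y_1) S(y_2) S(x_2) = S(y_1) PiR(x_1) y_2 S(y_3) S(x_2)
   = S(y_1) PiR(x_1) PiL(y_2) S(x_2), and PiR(x_1) commutes with PiL(y_2). *)
Lemma antipodeM x y : S (x ** y) = S y ** S x.
Proof.
rewrite antipode_PiL_r sw_amul; last by multilin.
transitivity (\sw_(a, b <- x) \sw_(c, d <- y) \sw_(e, f <- b) \sw_(g, h <- d)
   S (a ** c) ** (e ** g) ** S h ** S f).
  apply: eq_tlift => a b; apply: eq_tlift => c d.
  rewrite PiL_amulE amul_tlift; apply: eq_tlift => e f.
  rewrite -antipodeL amul_tlift tlift_amul amul_tlift.
  by apply: eq_tlift => g h; rewrite !amulA.
transitivity (\sw_(a, b <- x) \sw_(e, f <- a) \sw_(c, d <- y) \sw_(g, h <- c)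
   S (e ** g) ** (f ** h) ** S d ** S b).
  rewrite (sw_coassoc (F := fun e f b => \sw_(c, d <- y) \sw_(g, h <- c)
   S (e ** g) ** (f ** h) ** S d ** S b)); last by multilin.
  apply: eq_tlift => a b; rewrite exchange_tlift; apply: eq_tlift => e f.
  rewrite (sw_coassoc (F := fun g h d =>
    S (a ** g) ** (e ** h) ** S d ** S f)) //; last by multilin.
transitivity (\sw_(a, b <- x) \sw_(c, d <- y) PiR (a ** c) ** S d ** S b).
  apply: eq_tlift => a b; rewrite exchange_tlift; apply: eq_tlift => c d.
  rewrite -antipodeR sw_amul; last by multilin.
  rewrite !tlift_amul; apply: eq_tlift => e f.
  by rewrite !tlift_amul.
rewrite (antipode_PiR_l x) (antipode_PiL_r y) amul_tlift.
apply: eq_tlift => a b; rewrite tlift_amul.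
transitivity (\sw_(c, d <- y) \sw_(e, f <- c) S e ** PiR a ** f ** S d ** S b).
  apply: eq_tlift => c d; rewrite PiR_amulE !tlift_amul.
  by apply: eq_tlift.
rewrite (sw_coassoc (F := fun e f d => S e ** PiR a ** f ** S d ** S b));
  last by multilin.
apply: eq_tlift => c d.
rewrite -[RHS]amulA [PiL d ** _]amulA PiL_PiR_comm -antipodeL.
rewrite (linear_tliftE (L := fun z => S c ** (PiR a ** z ** S b)));
  last by multilin.
by apply: eq_tlift => e f; rewrite !amulA.
Qed.

(** For z = PiL x, PiR(z) = S(z_1) z_2 = S(1_1 z) 1_2 = S(z) S(1_1) 1_2 = S(z) PiR(1) = S(z). *)
Lemma antipode_PiL x : S (PiL x) = PiR (PiL x).
Proof.
rewrite -antipodeR sw_PiL_mulr; last by multilin.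
transitivity (S (PiL x) ** PiR one); first by rewrite PiR1 amul1r.
rewrite -antipodeR amul_tlift.
by apply: eq_tlift => a b; rewrite antipodeM amulA.
Qed.

Local Notation act := (@adjoint_action k H).

Lemma adjoint_action_bilinear : is_bilinear act.
Proof. by rewrite /adjoint_action; multilin. Qed.

Lemma adjoint_actionM x y m : act (x ** y) m = act x (act y m).
Proof.
rewrite /adjoint_action sw_amul; last by multilin.
apply: eq_tlift => a b; rewrite amul_tlift tlift_amul.
by apply: eq_tlift => c d; rewrite antipodeM !amulA.
Qed.

(** * The adjoint action under quantum commutativity *)

Section QuantumCommutative.
Hypothesis Hqc : quantum_commutative H.

(** The leg 1_2 can be taken in H_L, where S is [PiR]; what remains is quantum commutativity at the
    unit. *)
Lemma qc_adjoint_action1 m : act one m = m.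
Proof.
rewrite /adjoint_action -(sw1_PiL (F := fun a b => a ** m ** S b));
  last by multilin.
rewrite -[RHS]amul1l -(Hqc one m).
rewrite -[RHS](sw1_PiL (F := fun a b => a ** m ** PiR b));
  last by multilin.
by apply: eq_tlift => a b; rewrite antipode_PiL.
Qed.

(** Delta(PiL x) = PiL x 1_1 (x) 1_2 lets PiL x factor out on the left of the action of the unit. *)
Lemma qc_adjoint_action_PiL x m : act (PiL x) m = PiL x ** m.
Proof.
rewrite /adjoint_action sw_PiL_mull; last by multilin.
rewrite -[in RHS](qc_adjoint_action1 m) amul_tlift.
by apply: eq_tlift => a b; rewrite !amulA.
Qed.

Lemma qc_PiL_adjoint_action x m : PiL (act x (PiL m)) = PiL (act x m).
Proof.
rewrite /adjoint_action !(linear_tliftE (L := @PiL k H)); try exact: linearP.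
by apply: eq_tlift => a b; rewrite qc_PiL_amul_mid.
Qed.

End QuantumCommutative.
End WeakHopfAlgebra.
End Sweedler.

Unset Implicit Arguments.

Theorem proposition3p7 (k : fieldType) (H : weakHopfAlgType k)
  (Hqc : quantum_commutative H) :
  rota_baxter_paired_module (-1) (@adjoint_action k H) (@PiL k H) (@PiL k H).
Proof.
split; try exact: PiL_linear.
  split; [exact: adjoint_action_bilinear | exact: qc_adjoint_action1 |].
  exact: adjoint_actionM.
move=> b m; rewrite !qc_adjoint_action_PiL // PiL_PiL_amul.
(* The left-hand side and the first term on the right are now both PiL b PiL m; weight -1 makes the
   other two terms cancel. *)
by rewrite qc_PiL_adjoint_action // scaleN1r addrK.
Qed.
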